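(* Let $R$ be a commutative ring. The prime spectrum $\operatorname{Spec}(R)$ is noetherian with respect to the Zariski topology if and only if the flat opens of $\operatorname{Spec}(R)$ are stable under arbitrary intersections (that is, the intersection of any family of flat open subsets of $\operatorname{Spec}(R)$ is flat open).
   Context: All rings are commutative (with identity). For $f\in R$, put $V(f)=\{\mathfrak{p}\in\operatorname{Spec}(R): f\in\mathfrak{p}\}$. The flat (or inverse) topology on $\operatorname{Spec}(R)$ is the topology having the collection of subsets $V(f)$, with $f\in R$, as a sub-basis of opens; its open sets are called flat opens. *)

(* Defs.v *)
From HB Require Import structures.
From mathcomp Require Import all_boot all_order all_algebra.
From mathcomp Require Import all_classical topology.

Set Implicit Arguments.
Unset Strict Implicit.
Unset Printing Implicit Defensive.

Import GRing.Theory.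
Local Open Scope classical_set_scope.
Local Open Scope ring_scope.

(* The ideals of mathcomp.algebra.ring_quotient require a nontrivial ring;    *)
(* comPzRingType allows the zero ring, whose spectrum is empty.               *)

Definition ideal (R : comPzRingType) (I : set R) : Prop :=
  [/\ I 0, (forall x y, I x -> I y -> I (x + y)) &
      forall a x, I x -> I (a * x)].

Definition prime_ideal (R : comPzRingType) (P : set R) : Prop :=
  [/\ ideal P, ~ P 1 & forall x y, P (x * y) -> P x \/ P y].

Record spec (R : comPzRingType) : Type := Spec {
  spec_set :> set R;
  spec_prime : prime_ideal spec_set }.

HB.instance Definition _ (R : comPzRingType) := gen_eqMixin (spec R).
HB.instance Definition _ (R : comPzRingType) := gen_choiceMixin (spec R).

Definition V (R : comPzRingType) (f : R) : set (spec R) :=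
  [set p : spec R | (p : set R) f].

Definition Vset (R : comPzRingType) (E : set R) : set (spec R) :=
  [set p : spec R | E `<=` p].

(* Two copies of spec R, so that each can carry its own topology. *)
Definition zariski_spec (R : comPzRingType) : Type := spec R.
Definition flat_spec (R : comPzRingType) : Type := spec R.

HB.instance Definition _ (R : comPzRingType) := Choice.on (zariski_spec R).
HB.instance Definition _ (R : comPzRingType) := Choice.on (flat_spec R).

Section Zariski.
Variable R : comPzRingType.

(* The closed sets are the Vset E with E a subset of R. *)
Definition zariski_open : set_system (zariski_spec R) :=
  [set ~` Vset E | E in [set: set R]].

Lemma zariski_openT : zariski_open setT.
Proof.
exists [set 1] => //; apply/seteqP; split=> // p _ /(_ 1 erefl).
by case: (spec_prime p).
Qed.

Lemma zariski_openI (A B : set (zariski_spec R)) :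
  zariski_open A -> zariski_open B -> zariski_open (A `&` B).
Proof.
move=> [E _ <-] [F _ <-].
exists [set x | exists2 e, E e & exists2 f, F f & x = e * f] => //.
rewrite -setCU; congr (~` _); apply/seteqP; split=> p.
- move=> EFp; apply: contrapT => /not_orP[].
  move=> /existsNP[e /not_implyP[Ee npe]] /existsNP[f /not_implyP[Ff npf]].
  have /EFp : exists2 e', E e' & exists2 f', F f' & e * f = e' * f'.
    by exists e => //; exists f.
  by case: (spec_prime p) => _ _ pM /pM[].
- case: (spec_prime p) => -[_ _ pM] _ _ [sp|sp] _ [e Ee [f Ff ->]].
  + by rewrite mulrC; apply: pM; exact: sp.
  + by apply: pM; exact: sp.
Qed.

Lemma zariski_open_bigU (J : Type) (f : J -> set (zariski_spec R)) :
  (forall i, zariski_open (f i)) -> zariski_open (\bigcup_i f i).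
Proof.
move=> fop; have /choice[E fE] : forall i, exists E, ~` Vset E = f i.
  by move=> i; have [E _ <-] := fop i; exists E.
exists (\bigcup_i E i) => //.
rewrite -[RHS]setCK setC_bigcup; congr (~` _); apply/seteqP; split=> p.
- by move=> sp i _; rewrite -fE setCK => x Ex; apply: sp; exists i.
- by move=> sp x [i _ Ex]; have := sp i I; rewrite -fE setCK; apply.
Qed.

HB.instance Definition _ := isOpenTopological.Build (zariski_spec R)
  zariski_openT zariski_openI zariski_open_bigU.

End Zariski.

HB.instance Definition _ (R : comPzRingType) :=
  isSubBaseTopological.Build (flat_spec R) (range (@V R)) id.

Definition noetherian_space (T : topologicalType) : Prop :=
  forall C : nat -> set T,
    (forall n, closed (C n)) -> (forall n, C n.+1 `<=` C n) ->
    exists N, forall n, (N <= n)%N -> C n = C N.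

(* Main.v *)
Require Import Defs.
From mathcomp Require Import all_boot all_order all_algebra finmap.
From mathcomp Require Import all_classical topology.

(** Call a subset [E] of [R] finitely defining when its vanishing locus
    [Vset E] is already cut out by finitely many elements of [E].  Both sides
    of the equivalence say that every subset of [R] is finitely defining.

    For noetherianity this is the usual dictionary between chain conditions
    and finiteness: if no finite part of [E] suffices, adding elements of [E]
    one at a time produces a strictly decreasing sequence of closed sets;
    conversely, the closed sets of a decreasing sequence are the loci of an
    increasing sequence of ideals, and a finite part of the union of these
    ideals lies in one of them.

    For the flat topology, a flat open that contains [p] contains [Vset s] for
    some finite part [s] of [p], hence contains [Vset p].  So a flat open, and
    likewise an intersection of flat opens, is the union of the [Vset p] for
    [p] in it, and each [Vset p] is flat open as soon as [p] is finitely
    defining.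

    The remaining implication resembles Cohen's theorem.  If some [E] is not
    finitely defining, Zorn's lemma gives a maximal such [M], and a maximal one
    is a prime ideal.  Stability makes [Vset M], the intersection of the [V x]
    for [x] in [M], flat open; it contains the point [M], so it contains
    [Vset s] for some finite part [s] of [M], contradicting the choice of [M]. *)

Set Implicit Arguments.
Unset Strict Implicit.
Unset Printing Implicit Defensive.

Import GRing.Theory.
Local Open Scope classical_set_scope.
Local Open Scope ring_scope.

(** * Finite parts of unions of chains *)

Lemma finite_sub_bigcup_chain (T : eqType) (F : set (set T)) (s : seq T) :
  total_on F subset -> F !=set0 -> [set` s] `<=` \bigcup_(X in F) X ->
  exists2 A, F A & [set` s] `<=` A.
Proof.
move=> Ftot [A0 FA0]; elim: s => [_|x s IHs sF]; first by exists A0.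
have [|A FA sA] := IHs.
  by move=> y /= ys; apply: sF; rewrite /= inE ys orbT.
have [B FB Bx] : (\bigcup_(X in F) X) x by apply: sF; rewrite /= mem_head.
have [AB|BA] := Ftot A B FA FB.
- by exists B => // y /=; rewrite inE => /predU1P[->|/sA/AB].
- by exists A => // y /=; rewrite inE => /predU1P[->|/sA]; first exact: BA.
Qed.

Section FinitelyDefining.
Variable R : comPzRingType.
Implicit Types (E F : set R) (s : seq R) (p : spec R).

Lemma VsetS E F : E `<=` F -> Vset F `<=` Vset E.
Proof. by move=> EF p; apply: subset_trans. Qed.

Lemma Vset_cons x s : Vset [set` x :: s] = V x `&` Vset [set` s].
Proof.
apply/seteqP; split=> p.
- move=> xsp; split; first by apply: xsp; rewrite /= mem_head.
  by move=> y /= ys; apply: xsp; rewrite /= inE ys orbT.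
- by move=> [px sp] y /=; rewrite inE => /predU1P[->|/sp].
Qed.

Definition finitely_defining E : Prop :=
  exists2 s : seq R, [set` s] `<=` E & Vset [set` s] `<=` Vset E.

(** * Maximal non finitely defining sets *)

(** Membership in [V x] takes over the role of [x], which can then be removed
    from the finite defining part.  This lets one argue with sets [x |` M]
    instead of the ideals generated by them. *)
Lemma finitely_defining_adjoin M x :
  finitely_defining (x |` M) ->
  exists2 s : seq R, [set` s] `<=` M &
    forall p, Vset [set` s] p -> V x p -> Vset M p.
Proof.
move=> [s sxM Vs]; exists [seq y <- s | y != x].
  move=> y /=; rewrite mem_filter => /andP[/eqP yx /sxM[]//].
move=> p sp px; apply: (VsetS (@subsetUr _ [set x] M)); apply: Vs => y /= ys.
have [->//|yx] := eqVneq y x.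
by apply: sp; rewrite /= mem_filter yx.
Qed.

(** Each clause exhibits finitely many elements of [M] that would define
    [Vset M] if the clause failed: a prime that contains [x] and [y] contains
    [x + y], and a prime that contains [x * y] contains [x] or [y]. *)
Lemma prime_ideal_maximal M :
  ~ finitely_defining M ->
  (forall x, ~ M x -> finitely_defining (x |` M)) -> prime_ideal M.
Proof.
move=> nM maxM.
have adjoin x : ~ M x -> exists2 s : seq R, [set` s] `<=` M &
    forall p, Vset [set` s] p -> V x p -> Vset M p.
  by move=> /maxM; apply: finitely_defining_adjoin.
have consM x s : M x -> [set` s] `<=` M -> [set` x :: s] `<=` M.
  by move=> Mx sM y /=; rewrite inE => /predU1P[->|/sM].
split.
- split.
  + apply: contrapT => /adjoin[s sM Vs]; apply: nM; exists s => // p sp.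
    by apply: Vs => //; case: (spec_prime p) => -[].
  + move=> x y Mx My; apply: contrapT => /adjoin[s sM Vs]; apply: nM.
    exists [:: x, y & s]; first exact: consM Mx (consM _ _ My sM).
    move=> p; rewrite !Vset_cons => -[px [py sp]]; apply: Vs => //.
    by case: (spec_prime p) => -[_ pD _] _ _; apply: pD.
  + move=> a x Mx; apply: contrapT => /adjoin[s sM Vs]; apply: nM.
    exists (x :: s); first exact: consM.
    move=> p; rewrite Vset_cons => -[px sp]; apply: Vs => //.
    by case: (spec_prime p) => -[_ _ pM] _ _; apply: pM.
- move=> M1; apply: nM; exists [:: 1]; first exact: consM.
  by move=> p; rewrite Vset_cons => -[p1 _]; case: (spec_prime p).
- move=> x y Mxy; apply: contrapT => /not_orP[].
  move=> /adjoin[s sM Vs] /adjoin[t tM Vt]; apply: nM.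
  exists (x * y :: s ++ t).
    by apply: consM => // z /=; rewrite mem_cat => /orP[/sM|/tM].
  move=> p; rewrite Vset_cons => -[pxy stp].
  have sp : Vset [set` s] p by move=> z /= zs; apply: stp; rewrite /= mem_cat zs.
  have tp : Vset [set` t] p.
    by move=> z /= zt; apply: stp; rewrite /= mem_cat zt orbT.
  by case: (spec_prime p) => _ _ /(_ _ _ pxy)[px|py]; [apply: Vs|apply: Vt].
Qed.

(** The analogue of Cohen's theorem that a ring is noetherian once its primes
    are finitely generated: a maximal counterexample is itself prime. *)
Lemma finitely_defining_of_primes :
  (forall p, finitely_defining p) -> forall E, finitely_defining E.
Proof.
move=> primefd E; apply: contrapT => nE.
(* The empty set is finitely defining but is the union of the empty chain;
   admitting it in P lets every chain have an upper bound. *)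
pose P := [set A : set R | A = set0 \/ ~ finitely_defining A].
have [F FP Ftot|M [PM maxM]] := @Zorn_bigcup R P.
  have [->|/set0P[x [A FA Ax]]] := eqVneq (\bigcup_(X in F) X) set0.
    by left.
  right=> -[s sF Vs].
  have [||B FB xsB] := finite_sub_bigcup_chain (s := x :: s) Ftot.
  - by exists A.
  - by move=> y /=; rewrite inE => /predU1P[->|/sF]; first by exists A.
  have Bx : B x by apply: xsB; rewrite /= mem_head.
  have [B0|] := FP _ FB; first by rewrite B0 in Bx.
  apply; exists s => [y /= ys|]; first by apply: xsB; rewrite /= inE ys orbT.
  by move=> p /Vs; apply: VsetS => y By; exists B.
have nM : ~ finitely_defining M.
  case: PM => // M0 _; apply: (maxM E); last by right.
  by rewrite M0; split=> // E0; apply: nE; exists [::] => // p _ x /E0.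
have Mprime : prime_ideal M.
  apply: prime_ideal_maximal => // x nMx; apply: contrapT => nxM.
  apply: (maxM (x |` M)); last by right.
  by split=> [|xM]; [exact: subsetUr|apply/nMx/xM; left].
exact: nM (primefd (Spec Mprime)).
Qed.

(** * Noetherianity of the Zariski topology *)

Lemma closed_Vset E : closed (Vset E : set (zariski_spec R)).
Proof. by rewrite -openC; exists E. Qed.

Lemma closed_zariskiE (C : set (zariski_spec R)) :
  closed C -> C = Vset [set x | C `<=` @V R x].
Proof.
rewrite -openC => -[E _ /(congr1 setC)]; rewrite !setCK => <-.
apply/seteqP; split=> p; first by move=> Ep x /(_ p Ep).
by move=> sp x Ex; apply: sp => q; apply.
Qed.

Lemma noetherian_finitely_defining :
  noetherian_space (zariski_spec R) <-> forall E, finitely_defining E.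
Proof.
split=> [noeth E|fd C Ccl Cdec].
- apply: contrapT => nE.
  have /choice[f fP] s : exists x, [set` s] `<=` E ->
      E x /\ ~ (Vset [set` s] `<=` V x).
    have [sE|] := pselect ([set` s] `<=` E); last by exists 0.
    have /existsNP[p /not_implyP[sp /existsNP[x /not_implyP[Ex npx]]]] :
        ~ (Vset [set` s] `<=` Vset E) by move=> Vs; apply: nE; exists s.
    by exists x => _; split=> // /(_ p sp).
  (* While a finite part of E does not define Vset E, some element of E cuts
     its locus down strictly; t collects these elements. *)
  pose t n := iter n (fun s => f s :: s) [::].
  have tE n : [set` t n] `<=` E.
    elim: n => [|n IHn] // y /=.
    by rewrite inE => /predU1P[->|/IHn//]; case: (fP _ IHn).
  have [n|n|N] := noeth (fun n => Vset [set` t n] : set (zariski_spec R)).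
  + exact: closed_Vset.
  + by rewrite /= Vset_cons.
  + move=> /(_ N.+1 (leqnSn N)) /=; rewrite Vset_cons => VN.
    by case: (fP _ (tE N)) => _; apply; rewrite -VN.
- (* The largest sets with loci C n: unlike arbitrary defining sets, these
     increase with n. *)
  pose I n : set R := [set x | C n `<=` @V R x].
  have CI n : C n = Vset (I n) by apply: closed_zariskiE.
  have Cle m n : (m <= n)%N -> C n `<=` C m.
    move=> /subnKC <-; elim: (n - m)%N => [|k IHk]; first by rewrite addn0.
    by rewrite addnS => p /Cdec/IHk.
  have Ile m n : (m <= n)%N -> I m `<=` I n.
    by move=> mn x Ix p /(Cle _ _ mn)/Ix.
  have [s sI Vs] := fd (\bigcup_n I n).
  have [|||_ [N _ <-] sN] :=
    @finite_sub_bigcup_chain _ (range I) s.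
  + move=> _ _ [m _ <-] [n _ <-].
    by case/orP: (leq_total m n) => /Ile; [left|right].
  + by exists (I 0%N); exists 0%N.
  + by move=> x /sI[n _ Ix]; exists (I n) => //; exists n.
  exists N => n Nn; apply/seteqP; split; first exact: Cle.
  rewrite (CI N) (CI n) => p /(VsetS sN)/Vs; apply: VsetS => x Ix.
  by exists n.
Qed.

(** * Stability of flat opens *)

Lemma flat_open_V (x : R) : open (V x : set (flat_spec R)).
Proof.
exists [set V x]; last by rewrite bigcup_set1.
by move=> _ ->; apply: finI_from1; exists x.
Qed.

Lemma flat_open_Vset_seq s : open (Vset [set` s] : set (flat_spec R)).
Proof.
elim: s => [|x s IHs]; last first.
  by rewrite Vset_cons; apply: openI => //; exact: flat_open_V.
by rewrite (_ : Vset _ = setT); [exact: openT|apply/seteqP; split].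
Qed.

Lemma finI_from_V_sub (A : set (spec R)) p :
  finI_from (range (@V R)) id A -> A p ->
  exists2 s : seq R, [set` s] `<=` p & Vset [set` s] `<=` A.
Proof.
have finV (r : seq (set (spec R))) :
    (forall W, W \in r -> range (@V R) W /\ W p) ->
  exists2 s : seq R, [set` s] `<=` p &
    forall W, W \in r -> Vset [set` s] `<=` W.
  elim: r => [|W r IHr] rV; first by exists [::].
  have [|s sp sr] := IHr.
    by move=> W' rW'; apply: rV; rewrite inE rW' orbT.
  have [[x _ Vx] Wp] := rV W (mem_head _ _).
  exists (x :: s) => [y /=|W'].
    by rewrite inE => /predU1P[->|/sp//]; move: Wp; rewrite -Vx.
  rewrite Vset_cons inE => /predU1P[->|/sr sW'] q [Vxq sq].
    by rewrite -Vx.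
  exact: sW'.
move=> [D DV <-] Dp; have [W DW|s sp sD] := finV (enum_fset D).
  by split; [exact/set_mem/DV|exact: Dp].
by exists s => // q sq W DW; exact: sD DW _ sq.
Qed.

(** The loci of finite subsets of [p] form a neighbourhood basis of [p],
    because a finite intersection of subbasic opens [V x] is such a locus. *)
Lemma flat_open_Vset_sub (U : set (flat_spec R)) p :
  open U -> U p ->
  exists2 s : seq R, [set` s] `<=` p & Vset [set` s] `<=` U.
Proof.
move=> [B BI <-] [A BA Ap]; have [s sp sA] := finI_from_V_sub (BI A BA) Ap.
by exists s => // q /sA Aq; exists A.
Qed.

(** Every flat neighbourhood of [p] contains [Vset p], so [Vset p] is flat
    open exactly when [p] is finitely defining; stability makes it open as the
    intersection of the [V x] with [x] in [p], and conversely flat opens are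
    unions of such loci. *)
Lemma flat_open_bigcap_finitely_defining :
  (forall F : set (set (flat_spec R)),
     (forall U, F U -> open U) -> open (\bigcap_(U in F) U)) <->
  forall E, finitely_defining E.
Proof.
split=> [stable|fd F Fop].
- apply: finitely_defining_of_primes => p.
  have Vp_open : open (Vset p : set (flat_spec R)).
    rewrite (_ : Vset p = \bigcap_(U in [set V x | x in (p : set R)]) U).
      by apply: stable => _ [x _ <-]; exact: flat_open_V.
    by rewrite bigcap_image.
  exact: flat_open_Vset_sub Vp_open (fun _ => id).
- rewrite (_ : \bigcap_(U in F) U =
      \bigcup_(p in \bigcap_(U in F) U) Vset (p : spec R)).
    apply: bigcup_open => p _; have [s sp Vs] := fd p.
    rewrite (_ : Vset p = Vset [set` s]); first exact: flat_open_Vset_seq.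
    by apply/seteqP; split=> //; exact: VsetS.
  apply/seteqP; split=> [p Fp|q [p Fp pq] U FU]; first by exists p.
  have [s sp sU] := flat_open_Vset_sub (Fop U FU) (Fp U FU).
  by apply: sU; apply: subset_trans sp pq.
Qed.

End FinitelyDefining.

Theorem theorem5p1 (R : comPzRingType) :
  noetherian_space (zariski_spec R) <->
  (forall F : set (set (flat_spec R)),
     (forall U, F U -> open U) -> open (\bigcap_(U in F) U)).
Proof.
apply: iff_trans (noetherian_finitely_defining R) _.
exact: iff_sym (flat_open_bigcap_finitely_defining R).
Qed.
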